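(* Let $\mu\in\mathbb{R}$ be a constant. On the 8-dimensional symplectic manifold $T^*(S^2\times S^2)=T^*S^2\times T^*S^2$, whose points are written $(\mathbf{S}_1,\mathbf{P}_1,\mathbf{S}_2,\mathbf{P}_2)$ with $\mathbf{S}_\alpha,\mathbf{P}_\alpha\in\mathbb{R}^3$, $\|\mathbf{S}_\alpha\|=1$, $\mathbf{P}_\alpha\cdot\mathbf{S}_\alpha=0$ for $\alpha=1,2$, consider the Hamiltonian function $$ H_P(\mathbf{S}_1,\mathbf{S}_2,\mathbf{P}_1,\mathbf{P}_2)=\frac{\mu^2}{2}\,\bigl\|\mathbf{P}_1\times\mathbf{S}_1+\mathbf{P}_2\times\mathbf{S}_2\bigr\|^2+\frac12\,\Bigl((\mathbf{P}_1-\mathbf{P}_2)\cdot(\mathbf{S}_1\times\mathbf{S}_2)\Bigr)^2 . $$ Then the Hamiltonian system on $T^*(S^2\times S^2)$ defined by $H_P$ is completely integrable.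
   Context: $S^2\subset\mathbb{R}^3$ is the unit sphere, and $\cdot$, $\times$, $\|\cdot\|$ are the Euclidean inner product, cross product and norm of $\mathbb{R}^3$. Using the Euclidean metric, $T^*S^2$ is identified with $\{(\mathbf{S},\mathbf{P})\in\mathbb{R}^3\times\mathbb{R}^3:\|\mathbf{S}\|=1,\ \mathbf{P}\cdot\mathbf{S}=0\}$; under this identification the canonical symplectic form of $T^*S^2$ is the restriction of the canonical symplectic form of $T^*\mathbb{R}^3=\mathbb{R}^3\times\mathbb{R}^3$. $T^*(S^2\times S^2)$ carries the product (canonical) symplectic form and the associated Poisson bracket $\{\cdot,\cdot\}$. Completely integrable is meant in the sense of Liouville: on a symplectic manifold of dimension $2n$, the system with Hamiltonian $H$ is completely integrable if there exist $n$ smooth functions $f_1,\dots,f_n$ with $\{f_i,f_j\}=0$ and $\{H,f_i\}=0$ for all $i,j$, whose differentials are linearly independent on a dense open subset. Here $n=4$. *)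

(* Defs.v *)
From HB Require Import structures.
From mathcomp Require Import all_boot all_order all_algebra.
From mathcomp Require Import ring lra.
From mathcomp Require Import all_classical all_reals all_analysis.

Set Implicit Arguments.
Unset Strict Implicit.
Unset Printing Implicit Defensive.

Import Order.TTheory GRing.Theory Num.Theory.
Import numFieldNormedType.Exports.

Local Open Scope classical_set_scope.
Local Open Scope ring_scope.

(* The norm `|u| that the library puts on 'rV[R]_3 is the sup norm (it defines
   the usual topology); the Euclidean structure is therefore written out. *)
Definition dotv (R : realType) (u v : 'rV[R]_3) : R := \sum_i u 0 i * v 0 i.

Definition enorm (R : realType) (u : 'rV[R]_3) : R := Num.sqrt (dotv u u).

(* The indices i + 1 and i + 2 are taken modulo 3. *)
Definition crossv (R : realType) (u v : 'rV[R]_3) : 'rV[R]_3 :=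
  \row_(i < 3) (u 0 (i + 1) * v 0 (i + 2%:R) - u 0 (i + 2%:R) * v 0 (i + 1)).

(* E is meant to be finite-dimensional: there, f is C^(k+1) iff it is
   differentiable and x |-> 'd f x v is C^k for each fixed vector v. *)
Fixpoint Ck (R : realType) (E : normedModType R) (k : nat) (f : E -> R) : Prop :=
  if k is k'.+1 then
    (forall x, differentiable f x) /\ (forall v, Ck k' (fun x => 'd f x v))
  else continuous f.

Definition smooth (R : realType) (E : normedModType R) (f : E -> R) : Prop :=
  forall k, Ck k f.

(* In the next four definitions a closed submanifold of E is given by its
   underlying set M, its tangent spaces T x (linear subspaces of E, for x in M)
   and a constant bilinear form w on E restricting to a symplectic form on M.
   Since M is closed in E, the smooth functions on M are exactly the
   restrictions to M of the smooth functions f on E, and the differential at x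
   of such a restriction is 'd f x restricted to T x. *)

Definition is_ham_vec (R : realType) (E : normedModType R)
    (T : E -> set E) (w : E -> E -> R) (f : E -> R) (x X : E) : Prop :=
  T x X /\ forall v, T x v -> w X v = 'd f x v.

(* When w is nondegenerate on T x, the vector selected by [get] is the unique
   one; see [ham_vec_TSS] below for the manifold of interest. *)
Definition ham_vec (R : realType) (E : normedModType R)
    (T : E -> set E) (w : E -> E -> R) (f : E -> R) (x : E) : E :=
  get (is_ham_vec T w f x).

Definition poisson (R : realType) (E : normedModType R)
    (T : E -> set E) (w : E -> E -> R) (f g : E -> R) (x : E) : R :=
  w (ham_vec T w f x) (ham_vec T w g x).

Definition indep_differentials (R : realType) (E : normedModType R)
    (T : E -> set E) (n : nat) (f : 'I_n -> E -> R) (x : E) : Prop :=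
  forall c : 'I_n -> R,
    (forall v, T x v -> \sum_i c i * 'd (f i) x v = 0) -> forall i, c i = 0.

(* Liouville integrability, for M of dimension 2n.  The open subsets of M are
   the sets U `&` M with U open in E. *)
Definition completely_integrable (R : realType) (E : normedModType R) (n : nat)
    (M : set E) (T : E -> set E) (w : E -> E -> R) (H : E -> R) : Prop :=
  exists f : 'I_n -> E -> R,
    [/\ forall i, smooth (f i),
        forall i j x, M x -> poisson T w (f i) (f j) x = 0,
        forall i x, M x -> poisson T w H (f i) x = 0
      & exists U : set E,
          [/\ open U, M `<=` closure (U `&` M)
            & forall x, (U `&` M) x -> indep_differentials T f x]].

(* Points of T^*R^3 are pairs (S, P), and points of T^*R^3 x T^*R^3 are pairs
   ((S1, P1), (S2, P2)). *)
Notation TR3 R := ('rV[R]_3 * 'rV[R]_3)%type.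
Notation TR3R3 R := (TR3 R * TR3 R)%type.

Definition wR3 (R : realType) (u v : TR3 R) : R :=
  dotv u.1 v.2 - dotv u.2 v.1.

Definition wR3R3 (R : realType) (u v : TR3R3 R) : R :=
  wR3 u.1 v.1 + wR3 u.2 v.2.

Definition TS (R : realType) : set (TR3 R) :=
  [set x | enorm x.1 = 1 /\ dotv x.2 x.1 = 0].

(* The kernel of the differential at x = (S, P) of the defining equations
   S . S = 1 and P . S = 0 of T^*S^2. *)
Definition tangentTS (R : realType) (x : TR3 R) : set (TR3 R) :=
  [set v | dotv x.1 v.1 = 0 /\ dotv v.2 x.1 + dotv x.2 v.1 = 0].

Definition TSS (R : realType) : set (TR3R3 R) :=
  [set x | TS x.1 /\ TS x.2].

Definition tangentTSS (R : realType) (x : TR3R3 R) : set (TR3R3 R) :=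
  [set v | tangentTS x.1 v.1 /\ tangentTS x.2 v.2].

Definition H_P (R : realType) (mu : R) (x : TR3R3 R) : R :=
  let S1 := x.1.1 in let P1 := x.1.2 in
  let S2 := x.2.1 in let P2 := x.2.2 in
  mu ^+ 2 / 2 * enorm (crossv P1 S1 + crossv P2 S2) ^+ 2
  + 1 / 2 * (dotv (P1 - P2) (crossv S1 S2)) ^+ 2.

Lemma dotvC (R : realType) (u v : 'rV[R]_3) : dotv u v = dotv v u.
Proof. by apply: eq_bigr => i _; rewrite mulrC. Qed.

Lemma dotvDl (R : realType) (u v w : 'rV[R]_3) :
  dotv (u + v) w = dotv u w + dotv v w.
Proof. by rewrite -big_split; apply: eq_bigr => i _; rewrite mxE mulrDl. Qed.

Lemma dotvZl (R : realType) (a : R) (u v : 'rV[R]_3) :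
  dotv (a *: u) v = a * dotv u v.
Proof. by rewrite /dotv mulr_sumr; apply: eq_bigr => i _; rewrite mxE mulrA. Qed.

Lemma dotvNl (R : realType) (u v : 'rV[R]_3) : dotv (- u) v = - dotv u v.
Proof. by rewrite -scaleN1r dotvZl mulN1r. Qed.

Lemma enorm1P (R : realType) (u : 'rV[R]_3) : enorm u = 1 <-> dotv u u = 1.
Proof.
have d0 : 0 <= dotv u u by apply: sumr_ge0 => i _; rewrite -expr2 sqr_ge0.
split=> [h|h]; last by rewrite /enorm h sqrtr1.
by rewrite -(sqr_sqrtr d0) -/(enorm u) h expr1n.
Qed.

Lemma linear_dotv (R : realType) (l : 'rV[R]_3 -> R) :
  (forall a u v, l (a *: u + v) = a * l u + l v) ->
  exists a, forall v, l v = dotv a v.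
Proof.
move=> hl; exists (\row_i l (delta_mx 0 i)) => v.
have hl0 : l 0 = 0 by have := hl (-1) 0 0; rewrite scaler0 addr0; lra.
rewrite {1}(row_sum_delta v) (big_morph l (id1 := 0) (op1 := +%R)) //.
  apply: eq_bigr => i _; have := hl (v 0 i) (delta_mx 0 i) 0.
  by rewrite !addr0 hl0 addr0 mxE mulrC.
by move=> u w; have := hl 1 u w; rewrite scale1r mul1r.
Qed.

Lemma wR3R3C (R : realType) (u v : TR3R3 R) : wR3R3 u v = - wR3R3 v u.
Proof.
rewrite /wR3R3 /wR3 (dotvC u.1.1) (dotvC u.1.2) (dotvC u.2.1) (dotvC u.2.2).
by ring.
Qed.

Lemma TS_sharp (R : realType) (x : TR3 R) (a b : 'rV[R]_3) : TS x ->
  exists2 X, tangentTS x X &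
    forall v, tangentTS x v -> wR3 X v = dotv a v.1 + dotv b v.2.
Proof.
case: x => S P [/= /enorm1P SS PS].
pose k := dotv b S; pose m := dotv a S - dotv b P.
exists (b - k *: S, - a + m *: S + k *: P).
  rewrite /tangentTS/= (dotvC S) (dotvC P) !(dotvDl, dotvNl, dotvZl) SS PS.
  by rewrite (dotvC S P) PS /m /k; split; ring.
case=> vS vP [/= h1]; rewrite (dotvC vP) => h2; rewrite /wR3/=.
rewrite !(dotvDl, dotvNl, dotvZl) h1.
have -> : dotv S vP = - dotv P vS by apply/eqP; rewrite -addr_eq0 h2.
by ring.
Qed.

Lemma TSS_sharp (R : realType) (x : TR3R3 R) (l : TR3R3 R -> R) :
  (forall a u v, l (a *: u + v) = a * l u + l v) ->
  TSS x -> exists2 X, tangentTSS x X &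
    forall v, tangentTSS x v -> wR3R3 X v = l v.
Proof.
move=> hl [x1 x2].
have lin (j : 'rV[R]_3 -> TR3R3 R) :
    (forall a u v, j (a *: u + v) = a *: j u + j v) ->
    exists a, forall v, l (j v) = dotv a v.
  by move=> hj; apply: linear_dotv => a u v; rewrite hj hl.
have [|a1 ha1] := lin (fun v => ((v, 0), (0, 0))).
  move=> c u v.
  transitivity ((((c *: u + v), (c *: 0 + 0)), ((c *: 0 + 0), (c *: 0 + 0))) : TR3R3 R) => //.
  by rewrite scaler0 addr0.
have [|b1 hb1] := lin (fun v => ((0, v), (0, 0))).
  move=> c u v.
  transitivity ((((c *: 0 + 0), (c *: u + v)), ((c *: 0 + 0), (c *: 0 + 0))) : TR3R3 R) => //.
  by rewrite scaler0 addr0.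
have [|a2 ha2] := lin (fun v => ((0, 0), (v, 0))).
  move=> c u v.
  transitivity ((((c *: 0 + 0), (c *: 0 + 0)), ((c *: u + v), (c *: 0 + 0))) : TR3R3 R) => //.
  by rewrite scaler0 addr0.
have [|b2 hb2] := lin (fun v => ((0, 0), (0, v))).
  move=> c u v.
  transitivity ((((c *: 0 + 0), (c *: 0 + 0)), ((c *: 0 + 0), (c *: u + v))) : TR3R3 R) => //.
  by rewrite scaler0 addr0.
have [X1 tX1 hX1] := TS_sharp a1 b1 x1.
have [X2 tX2 hX2] := TS_sharp a2 b2 x2.
exists (X1, X2) => // v [v1 v2].
have lD u w : l (u + w) = l u + l w by have := hl 1 u w; rewrite scale1r mul1r.
rewrite /wR3R3/= hX1// hX2// -ha1 -hb1 -ha2 -hb2 -!lD.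
congr (l _); case: v {v1 v2} => [[? ?] [? ?]].
by congr ((_, _), (_, _)); rewrite /= ?addr0 ?add0r.
Qed.

Lemma ham_vec_TSS (R : realType) (f : TR3R3 R -> R) (x X : TR3R3 R) : TSS x ->
  is_ham_vec (@tangentTSS R) (@wR3R3 R) f x X <->
  X = ham_vec (@tangentTSS R) (@wR3R3 R) f x.
Proof.
move=> xM.
have [a u v|Y tY hY] := TSS_sharp (l := 'd f x) _ xM; first by rewrite linearP.
have hh : is_ham_vec (@tangentTSS R) (@wR3R3 R) f x
    (ham_vec (@tangentTSS R) (@wR3R3 R) f x).
  by apply: (@getI _ _ Y); split.
split=> [[tX hX]|->//]; case: hh; move: (ham_vec _ _ _ _) => Z tZ hZ.
have eqXZ (l : TR3R3 R -> R) :
    (forall a u v, l (a *: u + v) = a * l u + l v) -> l X = l Z.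
  move=> hl; have [W tW hW] := TSS_sharp hl xM.
  by rewrite -!hW// wR3R3C hX// [RHS]wR3R3C hZ.
case: X Z eqXZ {tX hX tZ hZ} => [[X1 X2] [X3 X4]] [[Z1 Z2] [Z3 Z4]] e.
congr ((_, _), (_, _)); apply/rowP => i.
- by apply: (e (fun x => x.1.1 0 i)) => a u v; rewrite /= !mxE.
- by apply: (e (fun x => x.1.2 0 i)) => a u v; rewrite /= !mxE.
- by apply: (e (fun x => x.2.1 0 i)) => a u v; rewrite /= !mxE.
- by apply: (e (fun x => x.2.2 0 i)) => a u v; rewrite /= !mxE.
Qed.

(* Main.v *)
Require Import Defs.
From HB Require Import structures.
From mathcomp Require Import all_boot all_order all_algebra.
From mathcomp Require Import ring lra.
From mathcomp Require Import all_classical all_reals all_analysis.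

(* Put M = P1 x S1 + P2 x S2.  Up to sign M is the total angular momentum,
   whose components generate the diagonal rotations, and H_P is a function of
   |M|^2 and (P1 - P2) . (S1 x S2) = (S1 + S2) . M.  Both are invariant under
   rotations, hence commute with e . M for a fixed unit vector e and with
   |M|^2, and so does S1 . S2.  The Hamiltonian vector field of S1 . S2 is
   vertical and preserves M, so S1 . S2 commutes with (S1 + S2) . M as well.
   The integrals e . M, |M|^2, S1 . S2 and (S1 + S2) . M are independent where
   S1, S2 are not parallel and e, M, S1 + S2 are linearly independent. *)

Set Implicit Arguments.
Unset Strict Implicit.
Unset Printing Implicit Defensive.

Import Order.TTheory GRing.Theory Num.Theory.
Import numFieldNormedType.Exports.

Local Open Scope classical_set_scope.
Local Open Scope ring_scope.

(** * Vector algebra of the inner and cross products in three dimensions *)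

Section Cross.
Variable R : realType.
Implicit Types (a b : R) (u v w e S P : 'rV[R]_3).

Lemma dotvE u v : dotv u v =
  u 0 0 * v 0 0 + u 0 1 * v 0 1 + u 0 2%:R * v 0 2%:R.
Proof.
rewrite /dotv !big_ord_recl big_ord0 addr0 !addrA.
by congr (_ * _ + _ * _ + _ * _); congr (_ 0 _); apply/val_inj.
Qed.

(** Literal indices replace the indices modulo 3, so that identities between coordinates become
    goals for [ring]. *)
Lemma crossvE u v :
  [/\ crossv u v 0 0 = u 0 1 * v 0 2%:R - u 0 2%:R * v 0 1,
      crossv u v 0 1 = u 0 2%:R * v 0 0 - u 0 0 * v 0 2%:R
    & crossv u v 0 2%:R = u 0 0 * v 0 1 - u 0 1 * v 0 0].
Proof.
by split; rewrite mxE; congr (_ * _ - _ * _); congr (_ 0 _); apply/val_inj.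
Qed.

Lemma row3P u v : u 0 0 = v 0 0 -> u 0 1 = v 0 1 -> u 0 2%:R = v 0 2%:R ->
  u = v.
Proof.
move=> e0 e1 e2; apply/rowP => -[[|[|[|//]]] i3].
- by rewrite (_ : Ordinal _ = 0) //; apply/val_inj.
- by rewrite (_ : Ordinal _ = 1) //; apply/val_inj.
- by rewrite (_ : Ordinal _ = 2%:R) //; apply/val_inj.
Qed.

Lemma dotvDr u v w : dotv u (v + w) = dotv u v + dotv u w.
Proof. by rewrite dotvC dotvDl !(dotvC u). Qed.

Lemma dotvZr a u v : dotv u (a *: v) = a * dotv u v.
Proof. by rewrite dotvC dotvZl dotvC. Qed.

Lemma dotvNr u v : dotv u (- v) = - dotv u v.
Proof. by rewrite dotvC dotvNl dotvC. Qed.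

Lemma dotv0r u : dotv u 0 = 0.
Proof. by rewrite -(scale0r u) dotvZr mul0r. Qed.

Lemma dotv0l u : dotv 0 u = 0.
Proof. by rewrite dotvC dotv0r. Qed.

Lemma dotvv_ge0 u : 0 <= dotv u u.
Proof. by apply: sumr_ge0 => i _; rewrite -expr2 sqr_ge0. Qed.

Lemma dotvv_eq0 u : dotv u u = 0 -> u = 0.
Proof.
move=> /psumr_eq0P u0; apply/rowP => i; rewrite mxE.
have /eqP := u0 (fun j _ => sqr_ge0 (u 0 j)) i isT.
by rewrite mulf_eq0 orbb => /eqP.
Qed.

Lemma dotv_delta u i : dotv u (delta_mx 0 i) = u 0 i.
Proof.
rewrite /dotv (bigD1 i) //= big1 ?addr0 => [|j /negbTE ji].
  by rewrite mxE !eqxx mulr1.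
by rewrite mxE ji andbF mulr0.
Qed.

Lemma crossvDl u v w : crossv (u + v) w = crossv u w + crossv v w.
Proof. by apply/rowP => i; rewrite !mxE; ring. Qed.

Lemma crossvZl a u v : crossv (a *: u) v = a *: crossv u v.
Proof. by apply/rowP => i; rewrite !mxE; ring. Qed.

Lemma crossvN u v : crossv u v = - crossv v u.
Proof. by apply/rowP => i; rewrite !mxE; ring. Qed.

Lemma crossvv u : crossv u u = 0.
Proof. by apply/rowP => i; rewrite !mxE; ring. Qed.

Lemma crossvDr u v w : crossv u (v + w) = crossv u v + crossv u w.
Proof. by apply/rowP => i; rewrite !mxE; ring. Qed.

Lemma crossv0r u : crossv u 0 = 0.
Proof. by apply/rowP => i; rewrite !mxE; ring. Qed.

Lemma dotv_crossC u v w : dotv (crossv u v) w = dotv u (crossv v w).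
Proof.
rewrite !dotvE; have [-> -> ->] := crossvE u v.
by have [-> -> ->] := crossvE v w; ring.
Qed.

Lemma dotv_cross_self u v : dotv u (crossv u v) = 0.
Proof. by rewrite -dotv_crossC crossvv dotv0l. Qed.

(** Rotations preserve the inner product: [crossv u] is antisymmetric. This makes inner products of
    rotated vectors invariants below. *)
Lemma dotv_cross_anti u v w :
  dotv (crossv u v) w + dotv v (crossv u w) = 0.
Proof.
by rewrite -[dotv v _]dotv_crossC (crossvN v) dotvNl subrr.
Qed.

Lemma dotv_cross_self2 u v : dotv u (crossv v u) = 0.
Proof. by rewrite crossvN dotvNr dotv_cross_self oppr0. Qed.

(** Lagrange's identity. *)
Lemma dotv_cross_cross u v : dotv (crossv u v) (crossv u v) =
  dotv u u * dotv v v - dotv u v ^+ 2.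
Proof. by rewrite !dotvE; have [-> -> ->] := crossvE u v; ring. Qed.

(** The Jacobi identity, in the form that [crossv u] is a derivation of the cross product. *)
Lemma crossv_jacobi u v w :
  crossv (crossv u v) w + crossv v (crossv u w) = crossv u (crossv v w).
Proof.
have [uv0 uv1 uv2] := crossvE u v; have [uw0 uw1 uw2] := crossvE u w.
have [vw0 vw1 vw2] := crossvE v w.
have [a0 a1 a2] := crossvE (crossv u v) w.
have [b0 b1 b2] := crossvE v (crossv u w).
have [c0 c1 c2] := crossvE u (crossv v w).
apply: row3P; rewrite [LHS]mxE.
- by rewrite a0 b0 c0 uv1 uv2 uw1 uw2 vw1 vw2; ring.
- by rewrite a1 b1 c1 uv0 uv2 uw0 uw2 vw0 vw2; ring.
- by rewrite a2 b2 c2 uv0 uv1 uw0 uw1 vw0 vw1; ring.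
Qed.

(** By Lagrange's identity the part of [w] orthogonal to the unit vector [u] has squared length |u x
    w|^2 = 0. *)
Lemma crossv_eq0 u w : dotv u u = 1 -> crossv u w = 0 -> w = dotv u w *: u.
Proof.
move=> uu uw0; have uw := dotv_cross_cross u w.
apply/subr0_eq/dotvv_eq0; move: uw; rewrite uw0 dotv0l uu.
rewrite !(dotvDl, dotvDr, dotvNl, dotvNr, dotvZl, dotvZr) uu (dotvC w u).
by move: (dotv u w) (dotv w w) => a b; lra.
Qed.

(** Both squares vanish, so [w] is parallel to [u] and to [v]; by hypothesis these unit vectors are
    not parallel to each other. *)
Lemma cross_unit_eq0 u v w : dotv u u = 1 -> dotv v v = 1 ->
  dotv u v ^+ 2 != 1 ->
  dotv (crossv u w) (crossv u w) + dotv (crossv v w) (crossv v w) = 0 -> w = 0.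
Proof.
move=> uu vv uv h0.
have hu := dotvv_ge0 (crossv u w); have hv := dotvv_ge0 (crossv v w).
have /dotvv_eq0/(crossv_eq0 uu) wu : dotv (crossv u w) (crossv u w) = 0 by lra.
have /dotvv_eq0/(crossv_eq0 vv) wv : dotv (crossv v w) (crossv v w) = 0 by lra.
have a : dotv u w = dotv v w * dotv u v by rewrite [in LHS]wv dotvZr.
have b : dotv v w = dotv u w * dotv u v by rewrite [in LHS]wu dotvZr (dotvC v).
suff uw0 : dotv u w = 0 by rewrite wu uw0 scale0r.
have : dotv u w * (dotv u v ^+ 2 - 1) = 0.
  by rewrite mulrBr expr2 mulrA -b -a; ring.
by move/eqP; rewrite mulf_eq0 subr_eq0 (negbTE uv) orbF => /eqP.
Qed.

End Cross.

(** * Differential calculus for scalar functions and for maps into three-space *)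

Section Smooth.
Variables (R : realType) (E : normedModType R).
Implicit Types (f g : E -> R) (F G : E -> 'rV[R]_3).

Lemma Ck_cst k (a : R) : Ck k (fun _ : E => a).
Proof.
elim: k a => [|k IH] a /=; first by move=> x; exact: cvg_cst.
split=> [x|v]; first exact: (differentiable_cst a x).
rewrite [X in Ck k X](_ : _ = fun=> 0); first exact: IH.
by apply/funext => x; rewrite (diff_cst a x).
Qed.

Lemma smooth_cst (a : R) : smooth (fun _ : E => a).
Proof. by move=> k; exact: Ck_cst. Qed.

Lemma smooth_differentiable f x : smooth f -> differentiable f x.
Proof. by move=> /(_ 1) []. Qed.

Lemma smooth_continuous f : smooth f -> continuous f.
Proof. by move=> /(_ 0). Qed.

Lemma linear_diff f x :
  (forall a u v, f (a *: u + v) = a * f u + f v) -> continuous f ->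
  differentiable f x /\ 'd f x = f :> (E -> R).
Proof.
move=> fl fc.
(* [f] is packed as a linear map into [R^o], that is, [R] as a module over itself. *)
have fl' : linear (f : E -> R^o) by [].
pose fM := GRing.isLinear.Build _ _ _ _ _ fl'.
pose fL : {linear E -> R^o} := HB.pack (f : E -> R^o) fM.
split; [exact: (@linear_differentiable _ _ _ fL)|exact: (@diff_lin _ _ _ fL)].
Qed.

Lemma smooth_linear f :
  (forall a u v, f (a *: u + v) = a * f u + f v) -> continuous f -> smooth f.
Proof.
move=> fl fc [|k] //=; split=> [x|v]; first by have [] := linear_diff x fl fc.
rewrite [X in Ck k X](_ : _ = fun=> f v); first exact: Ck_cst.
by apply/funext => x; have [_ ->] := linear_diff x fl fc.
Qed.

Lemma CkD k f g : Ck k f -> Ck k g -> Ck k (fun x => f x + g x).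
Proof.
elim: k f g => [|k IH] f g /=.
  by move=> fc gc x; apply: cvgD; [exact: fc|exact: gc].
move=> [fd fk] [gd gk]; split=> [x|v].
  exact: (differentiableD (fd x) (gd x)).
rewrite [X in Ck k X](_ : _ = fun x => 'd f x v + 'd g x v); first exact: IH.
by apply/funext => x; rewrite (diffD (fd x) (gd x)).
Qed.

Lemma diff_mul f g x v : differentiable f x -> differentiable g x ->
  'd (fun y => f y * g y) x v = 'd f x v * g x + f x * 'd g x v.
Proof.
move=> fd gd; rewrite (diffM fd gd).
by rewrite !fctE /= /GRing.scale/= addrC (mulrC (g x)).
Qed.

Lemma diff_add f g x v : differentiable f x -> differentiable g x ->
  'd (fun y => f y + g y) x v = 'd f x v + 'd g x v.
Proof. by move=> fd gd; apply: (congr1 (@^~ v) (diffD fd gd)). Qed.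

Lemma diff_sub f g x v : differentiable f x -> differentiable g x ->
  'd (fun y => f y - g y) x v = 'd f x v - 'd g x v.
Proof. by move=> fd gd; apply: (congr1 (@^~ v) (diffB fd gd)). Qed.

Lemma diff_dot3 f0 f1 f2 g0 g1 g2 x v :
  differentiable f0 x -> differentiable f1 x -> differentiable f2 x ->
  differentiable g0 x -> differentiable g1 x -> differentiable g2 x ->
  'd (fun y => f0 y * g0 y + f1 y * g1 y + f2 y * g2 y) x v =
  'd f0 x v * g0 x + 'd f1 x v * g1 x + 'd f2 x v * g2 x +
  (f0 x * 'd g0 x v + f1 x * 'd g1 x v + f2 x * 'd g2 x v).
Proof.
move=> f0d f1d f2d g0d g1d g2d.
have dM f g : differentiable f x -> differentiable g x ->
  differentiable (fun y => f y * g y) x := @differentiableM _ _ f g x.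
have dD f g : differentiable f x -> differentiable g x ->
  differentiable (fun y => f y + g y) x := @differentiableD _ _ _ f g x.
have d0 := dM _ _ f0d g0d; have d1 := dM _ _ f1d g1d.
have e : forall X Y D0 D1 D2 a0 b0 a1 b1 a2 b2 : R,
    X = Y + D2 -> Y = D0 + D1 -> D0 = a0 + b0 -> D1 = a1 + b1 ->
    D2 = a2 + b2 -> X = a0 + a1 + a2 + (b0 + b1 + b2).
  by move=> X Y D0 D1 D2 a0 b0 a1 b1 a2 b2 -> -> -> -> ->; ring.
exact: e (diff_add v (dD _ _ d0 d1) (dM _ _ f2d g2d)) (diff_add v d0 d1)
  (diff_mul v f0d g0d) (diff_mul v f1d g1d) (diff_mul v f2d g2d).
Qed.

(** The product rule keeps an undifferentiated factor; this lowers its order to the one the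
    induction in [CkM] provides. *)
Lemma CkS k f : Ck k.+1 f -> Ck k f.
Proof.
elim: k f => [|k IH] f [fd fk].
  by move=> x; exact: differentiable_continuous.
by split=> // v; exact: IH.
Qed.

Lemma CkM k f g : Ck k f -> Ck k g -> Ck k (fun x => f x * g x).
Proof.
elim: k f g => [|k IH] f g.
  by move=> fc gc x; apply: cvgM; [exact: fc|exact: gc].
move=> fk gk; have fk' := CkS fk; have gk' := CkS gk.
move: fk gk => [fd fk] [gd gk].
split=> [x|v]; first exact: (differentiableM (fd x) (gd x)).
rewrite [X in Ck k X](_ : _ = fun x => 'd f x v * g x + f x * 'd g x v).
  exact: CkD (IH _ _ (fk v) gk') (IH _ _ fk' (gk v)).
by apply/funext => x; rewrite diff_mul.
Qed.

Lemma smoothD f g : smooth f -> smooth g -> smooth (fun x => f x + g x).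
Proof. by move=> fs gs k; exact: CkD. Qed.

Lemma smoothM f g : smooth f -> smooth g -> smooth (fun x => f x * g x).
Proof. by move=> fs gs k; exact: CkM. Qed.

Lemma smoothB f g : smooth f -> smooth g -> smooth (fun x => f x - g x).
Proof.
move=> fs gs; rewrite (_ : (fun x => _) = fun x => f x + (-1) * g x).
  by apply: smoothD => //; apply: smoothM => //; exact: smooth_cst.
by apply/funext => x; rewrite mulN1r.
Qed.

Definition vsmooth F := forall i, smooth (fun x => F x 0 i).

(** Taken coordinatewise, so that only differentials of scalar functions occur, as in [Ck]. *)
Definition vdiff F x v : 'rV[R]_3 := \row_i 'd (fun y => F y 0 i) x v.

Lemma vdiffE F x v i : vdiff F x v 0 i = 'd (fun y => F y 0 i) x v.
Proof. by rewrite mxE. Qed.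

Lemma vsmooth_cst (a : 'rV[R]_3) : vsmooth (fun=> a).
Proof. by move=> i; exact: smooth_cst. Qed.

Lemma vdiff_cst (a : 'rV[R]_3) x v : vdiff (fun=> a) x v = 0.
Proof. by apply/rowP => i; rewrite !mxE (diff_cst (a 0 i) x). Qed.

Lemma continuous_coord F i : continuous F -> continuous (fun x => F x 0 i).
Proof.
move=> Fc x.
apply: (@continuous_comp _ _ _ F (fun M : 'rV[R]_3 => M 0 i)); first exact: Fc.
exact: coord_continuous.
Qed.

Lemma vsmooth_linear F : (forall a u v, F (a *: u + v) = a *: F u + F v) ->
  continuous F -> vsmooth F.
Proof.
move=> Fl Fc i; apply: smooth_linear => [a u v|]; first by rewrite Fl !mxE.
exact: continuous_coord.
Qed.

Lemma vdiff_linear F x v : (forall a u v, F (a *: u + v) = a *: F u + F v) ->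
  continuous F -> vdiff F x v = F v.
Proof.
move=> Fl Fc; apply/rowP => i; rewrite mxE.
have [| |_ ->] // := @linear_diff (fun y => F y 0 i) x.
  by move=> a u w; rewrite Fl !mxE.
exact: continuous_coord.
Qed.

Lemma vsmoothD F G : vsmooth F -> vsmooth G -> vsmooth (fun x => F x + G x).
Proof.
move=> Fs Gs i; rewrite (_ : (fun x => _) = fun x => F x 0 i + G x 0 i).
  exact: smoothD.
by apply/funext => x; rewrite mxE.
Qed.

Lemma vdiffD F G x v : vsmooth F -> vsmooth G ->
  vdiff (fun x => F x + G x) x v = vdiff F x v + vdiff G x v.
Proof.
move=> Fs Gs; apply/rowP => i; rewrite !mxE.
rewrite (_ : (fun x => _) = fun x => F x 0 i + G x 0 i).
  by rewrite (diffD (smooth_differentiable x (Fs i))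
    (smooth_differentiable x (Gs i))).
by apply/funext => y; rewrite mxE.
Qed.

Lemma vsmooth_crossv F G : vsmooth F -> vsmooth G ->
  vsmooth (fun x => crossv (F x) (G x)).
Proof.
move=> Fs Gs i.
rewrite (_ : (fun x => _) = fun x => F x 0 (i + 1) * G x 0 (i + 2%:R)
    - F x 0 (i + 2%:R) * G x 0 (i + 1)).
  by apply: smoothB; apply: smoothM.
by apply/funext => x; rewrite mxE.
Qed.

Lemma vdiff_crossv F G x v : vsmooth F -> vsmooth G ->
  vdiff (fun x => crossv (F x) (G x)) x v =
  crossv (vdiff F x v) (G x) + crossv (F x) (vdiff G x v).
Proof.
move=> Fs Gs; apply/rowP => i; rewrite !mxE.
have Fd i := smooth_differentiable x (Fs i).
have Gd i := smooth_differentiable x (Gs i).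
rewrite (_ : (fun x => _) = fun x => F x 0 (i + 1) * G x 0 (i + 2%:R)
    - F x 0 (i + 2%:R) * G x 0 (i + 1)); last first.
  by apply/funext => y; rewrite mxE.
have FGd j k : differentiable (fun y => F y 0 j * G y 0 k) x.
  exact: (differentiableM (Fd j) (Gd k)).
apply: etrans (diff_sub v (FGd _ _) (FGd _ _)) _.
apply: etrans (congr2 (fun a b => a - b) (diff_mul v (Fd _) (Gd _))
  (diff_mul v (Fd _) (Gd _))) _.
by rewrite opprD addrACA.
Qed.

Lemma smooth_dotv F G : vsmooth F -> vsmooth G ->
  smooth (fun x => dotv (F x) (G x)).
Proof.
move=> Fs Gs; under eq_fun do rewrite dotvE.
by do !apply: smoothD; apply: smoothM.
Qed.

Lemma diff_dotv F G x v : vsmooth F -> vsmooth G ->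
  'd (fun x => dotv (F x) (G x)) x v =
  dotv (vdiff F x v) (G x) + dotv (F x) (vdiff G x v).
Proof.
move=> Fs Gs; under eq_fun do rewrite dotvE.
have Fd i := smooth_differentiable x (Fs i).
have Gd i := smooth_differentiable x (Gs i).
have := vdiffE F x v; move: (vdiff F x v) => dF dFE.
have := vdiffE G x v; move: (vdiff G x v) => dG dGE.
rewrite !dotvE !dFE !dGE.
exact: (diff_dot3 v (Fd _) (Fd _) (Fd _) (Gd _) (Gd _) (Gd _)).
Qed.

End Smooth.

(** * The four integrals, their differentials and three Hamiltonian vector fields *)

Section Integrals.
Variable R : realType.
Implicit Types (x v : TR3R3 R) (a e : 'rV[R]_3).

Definition momentum x := crossv x.1.2 x.1.1 + crossv x.2.2 x.2.1.

Definition dmomentum x v :=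
  (crossv v.1.2 x.1.1 + crossv x.1.2 v.1.1) +
  (crossv v.2.2 x.2.1 + crossv x.2.2 v.2.1).

(** Being linear, it also serves as its own differential in [vdiff_spin_sum]. *)
Definition spin_sum x := x.1.1 + x.2.1.

Definition int_axis e x : R := dotv e (momentum x).
Definition int_norm x : R := dotv (momentum x) (momentum x).
Definition int_spin x : R := dotv (spin_sum x) (momentum x).
Definition int_angle x : R := dotv x.1.1 x.2.1.

Lemma continuous_S1 : continuous (fun x => x.1.1).
Proof.
by move=> x; apply: (@cvg_comp _ _ _ fst fst _ (nbhs x.1)); exact: cvg_fst.
Qed.

Lemma continuous_P1 : continuous (fun x => x.1.2).
Proof.
move=> x; apply: (@cvg_comp _ _ _ fst snd _ (nbhs x.1)).
  exact: cvg_fst.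
exact: cvg_snd.
Qed.

Lemma continuous_S2 : continuous (fun x => x.2.1).
Proof.
move=> x; apply: (@cvg_comp _ _ _ snd fst _ (nbhs x.2)).
  exact: cvg_snd.
exact: cvg_fst.
Qed.

Lemma continuous_P2 : continuous (fun x => x.2.2).
Proof.
by move=> x; apply: (@cvg_comp _ _ _ snd snd _ (nbhs x.2)); exact: cvg_snd.
Qed.

Lemma vsmooth_S1 : vsmooth (fun x => x.1.1).
Proof. by apply: vsmooth_linear => //; exact: continuous_S1. Qed.

Lemma vsmooth_P1 : vsmooth (fun x => x.1.2).
Proof. by apply: vsmooth_linear => //; exact: continuous_P1. Qed.

Lemma vsmooth_S2 : vsmooth (fun x => x.2.1).
Proof. by apply: vsmooth_linear => //; exact: continuous_S2. Qed.

Lemma vsmooth_P2 : vsmooth (fun x => x.2.2).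
Proof. by apply: vsmooth_linear => //; exact: continuous_P2. Qed.

Lemma vsmooth_momentum : vsmooth momentum.
Proof.
exact: vsmoothD (vsmooth_crossv vsmooth_P1 vsmooth_S1)
  (vsmooth_crossv vsmooth_P2 vsmooth_S2).
Qed.

Lemma vdiff_S1 x v : vdiff (fun x => x.1.1) x v = v.1.1.
Proof. by apply: vdiff_linear => //; exact: continuous_S1. Qed.

Lemma vdiff_P1 x v : vdiff (fun x => x.1.2) x v = v.1.2.
Proof. by apply: vdiff_linear => //; exact: continuous_P1. Qed.

Lemma vdiff_S2 x v : vdiff (fun x => x.2.1) x v = v.2.1.
Proof. by apply: vdiff_linear => //; exact: continuous_S2. Qed.

Lemma vdiff_P2 x v : vdiff (fun x => x.2.2) x v = v.2.2.
Proof. by apply: vdiff_linear => //; exact: continuous_P2. Qed.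

Lemma vdiff_momentum x v : vdiff momentum x v = dmomentum x v.
Proof.
have h1 := vsmooth_crossv vsmooth_P1 vsmooth_S1.
have h2 := vsmooth_crossv vsmooth_P2 vsmooth_S2.
rewrite (vdiffD _ _ h1 h2) (vdiff_crossv _ _ vsmooth_P1 vsmooth_S1).
rewrite (vdiff_crossv _ _ vsmooth_P2 vsmooth_S2).
by rewrite vdiff_S1 vdiff_P1 vdiff_S2 vdiff_P2.
Qed.

Lemma vsmooth_spin_sum : vsmooth spin_sum.
Proof. exact: vsmoothD vsmooth_S1 vsmooth_S2. Qed.

Lemma vdiff_spin_sum x v : vdiff spin_sum x v = spin_sum v.
Proof. by rewrite (vdiffD _ _ vsmooth_S1 vsmooth_S2) vdiff_S1 vdiff_S2. Qed.

Lemma smooth_int_axis e : smooth (int_axis e).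
Proof. exact: smooth_dotv (vsmooth_cst _ e) vsmooth_momentum. Qed.

Lemma smooth_int_norm : smooth int_norm.
Proof. exact: smooth_dotv vsmooth_momentum vsmooth_momentum. Qed.

Lemma smooth_int_spin : smooth int_spin.
Proof. exact: smooth_dotv vsmooth_spin_sum vsmooth_momentum. Qed.

Lemma smooth_int_angle : smooth int_angle.
Proof. exact: smooth_dotv vsmooth_S1 vsmooth_S2. Qed.

Lemma diff_int_axis e x v : 'd (int_axis e) x v = dotv e (dmomentum x v).
Proof.
apply: etrans (diff_dotv x v (vsmooth_cst _ e) vsmooth_momentum) _.
by rewrite vdiff_cst dotv0l add0r vdiff_momentum.
Qed.

Lemma diff_int_norm x v :
  'd int_norm x v = 2 * dotv (momentum x) (dmomentum x v).
Proof.
apply: etrans (diff_dotv x v vsmooth_momentum vsmooth_momentum) _.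
by rewrite vdiff_momentum dotvC mulr_natl mulr2n.
Qed.

Lemma diff_int_spin x v : 'd int_spin x v =
  dotv (spin_sum v) (momentum x) + dotv (spin_sum x) (dmomentum x v).
Proof.
apply: etrans (diff_dotv x v vsmooth_spin_sum vsmooth_momentum) _.
by rewrite vdiff_spin_sum vdiff_momentum.
Qed.

Lemma diff_int_angle x v :
  'd int_angle x v = dotv v.1.1 x.2.1 + dotv x.1.1 v.2.1.
Proof.
apply: etrans (diff_dotv x v vsmooth_S1 vsmooth_S2) _.
by rewrite vdiff_S1 vdiff_S2.
Qed.

(** The infinitesimal diagonal rotation about the axis [a], lifted to the cotangent bundle. *)
Definition rotation a x : TR3R3 R :=
  ((crossv a x.1.1, crossv a x.1.2), (crossv a x.2.1, crossv a x.2.2)).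

(** The spins stay fixed, and each momentum moves against the gradient of S1 . S2 projected to the
    tangent plane of its sphere. *)
Definition angle_field x : TR3R3 R :=
  ((0, int_angle x *: x.1.1 - x.2.1), (0, int_angle x *: x.2.1 - x.1.1)).

Lemma tangent_rotation a x : tangentTSS x (rotation a x).
Proof.
by split; split; rewrite /= ?dotv_cross_self2 ?dotv_cross_anti.
Qed.

(** The moment map property: a . M generates the rotation about - a. It holds on the whole ambient
    space, for arbitrary [v]. *)
Lemma wR3R3_rotation a x v : wR3R3 (rotation a x) v = - dotv a (dmomentum x v).
Proof.
rewrite /wR3R3 /wR3 /dmomentum/= !dotvDr !dotv_crossC.
by rewrite !(crossvN _ x.1.1) !(crossvN _ x.2.1) !dotvNr; ring.
Qed.

(** Equivariance of the moment map, a consequence of the Jacobi identity. *)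
Lemma dmomentum_rotation a x :
  dmomentum x (rotation a x) = crossv a (momentum x).
Proof. by rewrite /dmomentum/= !crossv_jacobi -crossvDr. Qed.

Lemma spin_sum_rotation a x :
  spin_sum (rotation a x) = crossv a (spin_sum x).
Proof. by rewrite /spin_sum crossvDr. Qed.

(** The radial parts drop out of the cross products, and the remaining torques - S2 x S1 and - S1 x
    S2 cancel. *)
Lemma dmomentum_angle_field x : dmomentum x (angle_field x) = 0.
Proof.
rewrite /dmomentum/= !crossv0r !addr0 !crossvDl !crossvZl !crossvv.
rewrite !scaler0 !add0r.
have N1 u w : crossv (- u) w = - crossv u w :> 'rV[R]_3.
  by rewrite -scaleN1r crossvZl scaleN1r.
by rewrite !N1 (crossvN x.2.1) opprK subrr.
Qed.

Section OnTSS.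
Variable x : TR3R3 R.
Hypothesis xM : TSS x.

Let S11 : dotv x.1.1 x.1.1 = 1. Proof. by case: xM => -[/enorm1P]. Qed.
Let S22 : dotv x.2.1 x.2.1 = 1. Proof. by case: xM => _ [/enorm1P]. Qed.

Lemma ham_axis e :
  is_ham_vec (@tangentTSS R) (@wR3R3 R) (int_axis e) x (rotation (- e) x).
Proof.
split; first exact: tangent_rotation.
by move=> v _; rewrite wR3R3_rotation dotvNl opprK diff_int_axis.
Qed.

(** By the chain rule |M|^2 generates a rotation about M itself, with an axis that depends on the
    point. *)
Lemma ham_norm : is_ham_vec (@tangentTSS R) (@wR3R3 R) int_norm x
  (rotation (- 2 *: momentum x) x).
Proof.
split; first exact: tangent_rotation.
by move=> v _; rewrite wR3R3_rotation dotvZl diff_int_norm; ring.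
Qed.

Lemma ham_angle :
  is_ham_vec (@tangentTSS R) (@wR3R3 R) int_angle x (angle_field x).
Proof.
split.
  split; split; rewrite /= ?dotv0r// addr0 dotvDl dotvZl dotvNl ?S11 ?S22.
    by rewrite (dotvC x.2.1) /int_angle; ring.
  by rewrite /int_angle; ring.
move=> v [[/= v1 _] [/= v2 _]]; rewrite diff_int_angle /wR3R3 /wR3 /=.
rewrite !(dotvDl, dotvZl, dotvNl, dotv0l) v1 v2 (dotvC v.1.1).
by ring.
Qed.

(** Only the field of [g] has to be known explicitly; [int_spin], whose field is never computed, can
    thus be placed on the left. *)
Lemma poissonE f g X : is_ham_vec (@tangentTSS R) (@wR3R3 R) g x X ->
  poisson (@tangentTSS R) (@wR3R3 R) f g x = 'd f x X.
Proof.
move=> hX; have /(ham_vec_TSS g X xM) eX := hX.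
have [_ hf] := (ham_vec_TSS f _ xM).2 erefl.
by rewrite /poisson -eX hf //; case: hX.
Qed.

Lemma poissonC f g : poisson (@tangentTSS R) (@wR3R3 R) f g x =
  - poisson (@tangentTSS R) (@wR3R3 R) g f x.
Proof. exact: wR3R3C. Qed.

Lemma poisson_self f : poisson (@tangentTSS R) (@wR3R3 R) f f x = 0.
Proof. by have := poissonC f f; lra. Qed.

End OnTSS.
End Integrals.

(** * Involution, conservation under [H_P], and independence of the differentials *)

Section Involution.
Variables (R : realType) (e : 'rV[R]_3).
Implicit Types (x v : TR3R3 R) (a : 'rV[R]_3).

Definition integral (i : 'I_4) : TR3R3 R -> R :=
  match nat_of_ord i with
  | 0 => int_axis e | 1 => @int_norm R | 2 => @int_angle R | _ => @int_spin R
  end.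

Lemma ord4_ind (P : 'I_4 -> Prop) :
  P 0 -> P 1 -> P 2%:R -> P 3%:R -> forall i, P i.
Proof.
move=> P0 P1 P2 P3 [[|[|[|[|//]]]] i4].
- by rewrite (_ : Ordinal _ = 0) //; apply/val_inj.
- by rewrite (_ : Ordinal _ = 1) //; apply/val_inj.
- by rewrite (_ : Ordinal _ = 2%:R) //; apply/val_inj.
- by rewrite (_ : Ordinal _ = 3%:R) //; apply/val_inj.
Qed.

Lemma smooth_integral i : smooth (integral i).
Proof.
elim/ord4_ind: i.
- exact: smooth_int_axis.
- exact: smooth_int_norm.
- exact: smooth_int_angle.
- exact: smooth_int_spin.
Qed.

Lemma diff_int_norm_rotation a x : 'd (@int_norm R) x (rotation a x) = 0.
Proof.
by rewrite diff_int_norm dmomentum_rotation dotv_cross_self2 mulr0.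
Qed.

Lemma diff_int_angle_rotation a x : 'd (@int_angle R) x (rotation a x) = 0.
Proof.
by rewrite diff_int_angle dotv_cross_anti.
Qed.

Lemma diff_int_spin_rotation a x : 'd (@int_spin R) x (rotation a x) = 0.
Proof.
by rewrite diff_int_spin dmomentum_rotation spin_sum_rotation dotv_cross_anti.
Qed.

Lemma diff_integral_axis i x : 'd (integral i) x (rotation (- e) x) = 0.
Proof.
elim/ord4_ind: i.
- rewrite [LHS]diff_int_axis dmomentum_rotation -scaleN1r crossvZl dotvZr.
  by rewrite dotv_cross_self mulr0.
- exact: diff_int_norm_rotation.
- exact: diff_int_angle_rotation.
- exact: diff_int_spin_rotation.
Qed.

Lemma diff_integral_norm i x :
  'd (integral i) x (rotation (- 2 *: momentum x) x) = 0.
Proof.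
elim/ord4_ind: i.
- rewrite [LHS]diff_int_axis dmomentum_rotation crossvZl crossvv.
  by rewrite scaler0 dotv0r.
- exact: diff_int_norm_rotation.
- exact: diff_int_angle_rotation.
- exact: diff_int_spin_rotation.
Qed.

Lemma diff_integral_angle i x : 'd (integral i) x (angle_field x) = 0.
Proof.
elim/ord4_ind: i.
- by rewrite [LHS]diff_int_axis dmomentum_angle_field dotv0r.
- by rewrite [LHS]diff_int_norm dmomentum_angle_field dotv0r mulr0.
- by rewrite [LHS]diff_int_angle dotv0l dotv0r addr0.
- rewrite [LHS]diff_int_spin dmomentum_angle_field dotv0r addr0.
  by rewrite (addr0 0 : spin_sum (angle_field x) = 0) dotv0l.
Qed.

Lemma poisson_integral i j x : TSS x ->
  poisson (@tangentTSS R) (@wR3R3 R) (integral i) (integral j) x = 0.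
Proof.
move=> xM; elim/ord4_ind: j.
- by rewrite (poissonE xM _ (ham_axis _ e)) diff_integral_axis.
- by rewrite (poissonE xM _ (ham_norm x)) diff_integral_norm.
- by rewrite (poissonE xM _ (ham_angle xM)) diff_integral_angle.
(* Here [integral j] is [int_spin]; antisymmetry moves the integral with a known field to the
   right. *)
elim/ord4_ind: i; last exact: poisson_self.
- by rewrite poissonC (poissonE xM _ (ham_axis _ e)) diff_integral_axis oppr0.
- by rewrite poissonC (poissonE xM _ (ham_norm x)) diff_integral_norm oppr0.
- by rewrite poissonC (poissonE xM _ (ham_angle xM)) diff_integral_angle oppr0.
Qed.

(** Each P x S is orthogonal to its own S, so only the mixed triple products survive; this
    identifies the second square in [H_P]. *)
Lemma int_spinE x :
  int_spin x = dotv (x.1.2 - x.2.2) (crossv x.1.1 x.2.1).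
Proof.
rewrite /int_spin /spin_sum /momentum !(dotvDl, dotvDr, dotvNl).
rewrite !dotv_cross_self2 add0r addr0 [LHS]addrC.
rewrite (dotvC x.2.1) dotv_crossC (dotvC x.1.1) dotv_crossC.
by rewrite (crossvN x.2.1) dotvNr.
Qed.

Lemma H_PE mu x : H_P mu x =
  mu ^+ 2 / 2 * int_norm x + 1 / 2 * (int_spin x * int_spin x).
Proof. by rewrite /H_P /enorm sqr_sqrtr ?dotvv_ge0 // -expr2 int_spinE. Qed.

Lemma diff_H_P mu x v : 'd (H_P mu) x v =
  mu ^+ 2 / 2 * 'd (@int_norm R) x v + int_spin x * 'd (@int_spin R) x v.
Proof.
rewrite (_ : H_P mu = fun x =>
  mu ^+ 2 / 2 * int_norm x + 1 / 2 * (int_spin x * int_spin x)); last first.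
  by apply/funext => y; rewrite H_PE.
have dn := smooth_differentiable x (@smooth_int_norm R).
have ds := smooth_differentiable x (@smooth_int_spin R).
have dZ (k : R) (f : TR3R3 R -> R) : differentiable f x ->
    differentiable (fun y => k * f y) x /\
    'd (fun y : TR3R3 R => k * f y) x v = k * 'd f x v.
  move=> df; have dk := differentiable_cst k x.
  split; first exact: (differentiableM dk df).
  by apply: etrans (diff_mul v dk df) _; rewrite (diff_cst k x) mul0r add0r.
have dss : differentiable (fun y => int_spin y * int_spin y) x.
  exact: (differentiableM ds ds).
have [dn' en] := dZ (mu ^+ 2 / 2) _ dn; have [dss' ess] := dZ (1 / 2) _ dss.
apply: etrans (diff_add v dn' dss') _; apply: (congr2 +%R en).
apply: etrans ess _; apply: etrans (congr1 _ (diff_mul v ds ds)) _.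
by move: ('d _ x v) (int_spin x) => a b; field.
Qed.

(** The differential of [H_P] is a combination of those of [int_norm] and [int_spin], and both
    vanish on the field [X] of any integral by involution. *)
Lemma poisson_H_integral mu i x : TSS x ->
  poisson (@tangentTSS R) (@wR3R3 R) (H_P mu) (integral i) x = 0.
Proof.
move=> xM; have [X hX] : exists X,
    is_ham_vec (@tangentTSS R) (@wR3R3 R) (integral i) x X.
  by exists (ham_vec (@tangentTSS R) (@wR3R3 R) (integral i) x);
    apply/ham_vec_TSS.
have n0 : 'd (@int_norm R) x X = 0.
  exact: etrans (esym (poissonE xM _ hX)) (poisson_integral 1 i xM).
have s0 : 'd (@int_spin R) x X = 0.
  exact: etrans (esym (poissonE xM _ hX)) (poisson_integral 3%:R i xM).
apply: etrans (poissonE xM _ hX) _; apply: etrans (diff_H_P _ _ _) _.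
have comb0 (k l a b : R) : a = 0 -> b = 0 -> k * a + l * b = 0 :> R.
  by move=> -> ->; rewrite !mulr0 addr0.
exact: comb0 n0 s0.
Qed.

Lemma sum_ord4 (F : 'I_4 -> R) : \sum_i F i = F 0 + F 1 + F 2%:R + F 3%:R.
Proof.
rewrite !big_ord_recl big_ord0 addr0 !addrA.
have -> : lift ord0 (lift ord0 (lift ord0 ord0)) = 3%:R :> 'I_4.
  by apply/val_inj.
have -> : lift ord0 (lift ord0 ord0) = 2%:R :> 'I_4 by apply/val_inj.
by have -> : lift ord0 ord0 = 1 :> 'I_4 by apply/val_inj.
Qed.

Lemma sum_diff_integral c x v : \sum_i c i * 'd (integral i) x v =
  c 0 * dotv e (dmomentum x v)
  + c 1 * (2 * dotv (momentum x) (dmomentum x v))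
  + c 2%:R * (dotv v.1.1 x.2.1 + dotv x.1.1 v.2.1)
  + c 3%:R * (dotv (spin_sum v) (momentum x) +
              dotv (spin_sum x) (dmomentum x v)).
Proof.
apply: etrans (sum_ord4 (fun i => c i * 'd (integral i) x v)) _.
have comb (k0 k1 k2 k3 a0 a1 a2 a3 b0 b1 b2 b3 : R) :
    a0 = b0 -> a1 = b1 -> a2 = b2 -> a3 = b3 ->
    k0 * a0 + k1 * a1 + k2 * a2 + k3 * a3 =
    k0 * b0 + k1 * b1 + k2 * b2 + k3 * b3.
  by move=> -> -> -> ->.
exact: comb (diff_int_axis e x v) (diff_int_norm x v) (diff_int_angle x v)
  (diff_int_spin x v).
Qed.

(** Vertical tangent vectors do not see S1 . S2 and force a linear relation among e, M and S1 + S2,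
    whose determinant is nonzero. One horizontal vector then handles the coefficient of S1 . S2. *)
Lemma indep_integral x : TSS x -> int_angle x ^+ 2 != 1 ->
  dotv (crossv e (spin_sum x)) (momentum x) != 0 ->
  indep_differentials (@tangentTSS R) integral x.
Proof.
move=> [[/enorm1P S11 PS1] [/enorm1P S22 PS2]] angle det c h.
have {}h v (tv : tangentTSS x v) :=
  etrans (esym (sum_diff_integral c x v)) (h v tv).
pose z := c 0 *: e + (2 * c 1) *: momentum x + c 3%:R *: spin_sum x.
have z0 : z = 0.
  (* On this vertical v, the combination is |S1 x z|^2 + |S2 x z|^2. *)
  apply: (cross_unit_eq0 S11 S22 angle).
  pose v : TR3R3 R := ((0, crossv x.1.1 z), (0, crossv x.2.1 z)).
  have tv : tangentTSS x v.
    by split; split; rewrite /= ?dotv0r// addr0 dotvC dotv_cross_self.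
  have := h v tv.
  rewrite (addr0 0 : spin_sum v = 0) /= dotv0r !dotv0l addr0 mulr0 addr0 add0r.
  have <- : dotv z (dmomentum x v) =
      dotv (crossv x.1.1 z) (crossv x.1.1 z) +
      dotv (crossv x.2.1 z) (crossv x.2.1 z).
    by rewrite /dmomentum/= !crossv0r !addr0 dotvDr !(dotvC z) !dotv_crossC.
  rewrite /z !(dotvDl, dotvZl) => <-.
  by ring.
(* Pairing z = 0 with the cross product of two of the three vectors leaves one coefficient times the
   determinant, up to sign and the factor 2. *)
have dz a : c 0 * dotv e a + 2 * c 1 * dotv (momentum x) a
    + c 3%:R * dotv (spin_sum x) a = 0.
  by rewrite -!dotvZl -!dotvDl -/z z0 dotv0l.
have cancel (k a : R) : k * a = 0 -> a != 0 -> k = 0.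
  by move=> /eqP; rewrite mulf_eq0 => /orP[/eqP//|->].
have c0 : c 0 = 0.
  have := dz (crossv (spin_sum x) (momentum x)).
  rewrite dotv_cross_self dotv_cross_self2 !mulr0 !addr0 -dotv_crossC.
  by move=> /cancel; apply.
have c1 : c 1 = 0.
  have := dz (crossv e (spin_sum x)).
  rewrite dotv_cross_self dotv_cross_self2 !mulr0 addr0 add0r dotvC.
  by move=> /cancel /(_ det); lra.
have c3 : c 3%:R = 0.
  have := dz (crossv (momentum x) e).
  rewrite dotv_cross_self dotv_cross_self2 !mulr0 !add0r dotvC dotv_crossC.
  by rewrite dotvC => /cancel; apply.
suff c2 : c 2%:R = 0 by elim/ord4_ind.
(* [w] is the part of S2 orthogonal to S1; the second entry of [v] preserves P1 . S1 = 0 to first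
   order. Along [v], S1 . S2 has derivative 1 - (S1 . S2)^2. *)
pose w := x.2.1 - int_angle x *: x.1.1.
pose v : TR3R3 R := ((w, - dotv x.1.2 w *: x.1.1), (0, 0)).
have tv : tangentTSS x v.
  split; split; rewrite /= ?dotv0r ?dotv0l ?addr0//.
    by rewrite dotvDr dotvNr dotvZr S11 mulr1 subrr.
  by rewrite dotvZl S11 mulr1 addNr.
have := h v tv; rewrite c0 c1 c3 !mul0r !add0r addr0 /=.
rewrite dotv0r addr0 dotvDl dotvNl dotvZl S22 -expr2 => /cancel; apply.
by rewrite subr_eq0 eq_sym.
Qed.

End Involution.

(** * Approximation along curves, and an injective curve on the sphere *)

Section Curves.
Variable R : realType.

Lemma closure_curve (T : topologicalType) (A : set T) (gamma : R -> T) :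
  {for 0, continuous gamma} -> (\forall t \near (0 : R)^', A (gamma t)) ->
  closure A (gamma 0).
Proof.
move=> gc gA B /gc gB.
have {}gB : \forall t \near (0 : R)^', B (gamma t) by exact: nbhs_dnbhs.
have [t [At Bt]] :=
  @filter_ex _ _ (Proper_dnbhs_numFieldType _) _ (filterI gA gB).
by exists (gamma t).
Qed.

(** The value [b] is taken at most once: at 0, which the punctured neighbourhood omits, or at a
    point that a small neighbourhood of 0 avoids. *)
Lemma near_injective_neq (T : Type) (s : R -> T) (b : T) : injective s ->
  \forall t \near (0 : R)^', s t <> b.
Proof.
move=> s_inj; have [[t0 st0]|nb] := pselect (exists t, s t = b); last first.
  by near=> t => st; apply: nb; exists t.
have [t00|t00] := eqVneq t0 0.
  near=> t => st; have : t != 0 by near: t; exact: nbhs_dnbhs_neq.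
  by rewrite -t00 => /eqP; apply; apply: s_inj; rewrite st0.
near=> t => st; have : t != t0.
  near: t; apply: nbhs_dnbhs; apply: open_nbhs_nbhs.
  split; first exact: open_neq.
  by rewrite /= eq_sym.
by move/eqP; apply; apply: s_inj; rewrite st0.
Unshelve. all: by end_near. Qed.

Lemma continuous_pair (T U V : topologicalType) (f : T -> U) (g : T -> V) t :
  {for t, continuous f} -> {for t, continuous g} ->
  {for t, continuous (fun x => (f x, g x))}.
Proof. by move=> fc gc; exact: cvg_pair. Qed.

Variables (S w : 'rV[R]_3).
Hypotheses (SS : dotv S S = 1) (Sw : dotv S w = 0) (w0 : 0 < dotv w w).

(* Inverse stereographic projection from -S, restricted to a line. *)
Definition stereo (t : R) : 'rV[R]_3 :=
  (1 + t ^+ 2 * dotv w w)^-1 *: ((1 - t ^+ 2 * dotv w w) *: S + (2 * t) *: w).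

Let den_gt0 t : 0 < 1 + t ^+ 2 * dotv w w.
Proof. by apply: ltr_pwDl => //; rewrite mulr_ge0 ?sqr_ge0 ?ltW. Qed.

Lemma stereo0 : stereo 0 = S.
Proof.
by rewrite /stereo expr0n !mul0r addr0 subr0 invr1 mulr0 scale0r addr0 !scale1r.
Qed.

Lemma dotv_stereo t : dotv (stereo t) (stereo t) = 1.
Proof.
have := lt0r_neq0 (den_gt0 t); rewrite /stereo.
rewrite !(dotvZl, dotvZr, dotvDl, dotvDr) (dotvC w S) Sw SS.
by move: (dotv w w) => k k0; field.
Qed.

Lemma stereo_inj : injective stereo.
Proof.
move=> t s ts; have := congr1 (dotv w) ts; have := congr1 (dotv S) ts.
have := lt0r_neq0 (den_gt0 t); have := lt0r_neq0 (den_gt0 s); rewrite /stereo.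
rewrite !(dotvZl, dotvZr, dotvDl, dotvDr) (dotvC w S) Sw SS.
rewrite !mulr0 !addr0 !add0r !mulr1.
have := w0; move: (dotv w w) => k k0 ds dt e1 e2.
(* The component along S determines the denominator, since (1 - r^2 k) / (1 + r^2 k) + 1 = 2 / (1 +
   r^2 k). The component along w then determines the parameter. *)
have e : (1 + t ^+ 2 * k)^-1 = (1 + s ^+ 2 * k)^-1.
  have h r : 1 + r ^+ 2 * k != 0 ->
      (1 + r ^+ 2 * k)^-1 = ((1 + r ^+ 2 * k)^-1 * (1 - r ^+ 2 * k) + 1) / 2.
    by move=> r0; field.
  by rewrite (h t) // (h s) // e1.
move: e2; rewrite e => /(mulfI (invr_neq0 ds)) /(mulIf (lt0r_neq0 k0)).
by move/(mulfI (_ : 2 != 0)); apply; rewrite pnatr_eq0.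
Qed.

Lemma continuous_stereo : continuous stereo.
Proof.
move=> t.
have cq : r ^+ 2 * dotv w w @[r --> t] --> t ^+ 2 * dotv w w.
  by apply: cvgM; [exact: exprn_continuous|exact: cvg_cst].
apply: cvgZ.
  apply: cvgV; first exact: lt0r_neq0.
  by apply: cvgD => //; exact: cvg_cst.
apply: cvgD; apply: cvgZ; try exact: cvg_cst.
  by apply: cvgB => //; exact: cvg_cst.
by apply: cvgM; [exact: cvg_cst|exact: cvg_id].
Qed.

End Curves.

(** * Openness and density of the regular set *)

Section Density.
Variables (R : realType) (e : 'rV[R]_3).
Hypothesis ee : dotv e e = 1.
Implicit Types x : TR3R3 R.

Lemma exists_orthogonal (S : 'rV[R]_3) : dotv S S = 1 ->
  exists2 w, dotv S w = 0 & 0 < dotv w w.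
Proof.
(* The squared coordinates sum to 1, so the first two cannot both equal 1; some basis vector is
   therefore not parallel to S. *)
move=> SS; have [i Si] : exists i, 1 - S 0 i ^+ 2 != 0.
  have [S0|] := eqVneq (1 - S 0 0 ^+ 2) 0; last by exists 0.
  exists 1; move: SS S0; rewrite dotvE -!expr2.
  have := sqr_ge0 (S 0 2%:R); move: (S 0 0 ^+ 2) (S 0 1 ^+ 2) (S 0 2%:R ^+ 2).
  by move=> a b c c0 abc a1; apply/eqP; lra.
exists (crossv S (delta_mx 0 i)); first exact: dotv_cross_self.
rewrite lt0r dotvv_ge0 andbT dotv_cross_cross SS !dotv_delta mxE !eqxx mulr1.
exact: Si.
Qed.

Lemma continuous_dotv (a : 'rV[R]_3) : continuous (dotv a).
Proof.
apply: smooth_continuous; apply: (smooth_dotv (vsmooth_cst _ a)).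
by apply: vsmooth_linear => // u; exact: cvg_id.
Qed.

(** An intermediate set whose inequalities involve the spins alone: density is shown by moving first
    a spin, then the momenta. *)
Definition generic_spins : set (TR3R3 R) :=
  [set x | TSS x /\ int_angle x ^+ 2 != 1 /\ crossv e (spin_sum x) != 0].

Definition regular : set (TR3R3 R) :=
  [set x | int_angle x ^+ 2 != 1 /\
           dotv (crossv e (spin_sum x)) (momentum x) != 0].

Lemma open_regular : open regular.
Proof.
(* The product of the two quantities required to be nonzero, so that [regular] is the nonvanishing
   set of one continuous function. *)
pose g x := (int_angle x * int_angle x - 1) *
            dotv (crossv e (spin_sum x)) (momentum x).
have gs : smooth g.
  apply: smoothM.
    apply: smoothB; [apply: smoothM; exact: smooth_int_angle|].
    exact: smooth_cst.
  apply: (smooth_dotv _ (@vsmooth_momentum R)).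
  exact: vsmooth_crossv (vsmooth_cst _ e) (@vsmooth_spin_sum R).
have -> : regular = g @^-1` [set y | y != 0].
  apply/seteqP; split=> x /=; rewrite /g mulf_eq0 negb_or subr_eq0 -expr2.
    by move=> [-> ->].
  by move=> /andP[].
apply: open_comp; last exact: open_neq.
by move=> x _; exact: smooth_continuous.
Qed.

Lemma generic_spins_dense : @TSS R `<=` closure generic_spins.
Proof.
move=> [[S1 P1] [S2 P2]] [[/= /enorm1P S11 PS1] [/= S22e PS2]].
have S22 : dotv S2 S2 = 1 by apply/enorm1P.
have [w S1w w0] := exists_orthogonal S11.
pose Q := stereo S1 w.
(* S1 moves along the sphere, and P1 is projected to the moving tangent plane so that the curve
   stays in [TSS]. *)
pose gamma t : TR3R3 R := ((Q t, P1 - dotv P1 (Q t) *: Q t), (S2, P2)).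
have -> : ((S1, P1), (S2, P2)) = gamma 0.
  by rewrite /gamma /Q stereo0 // PS1 scale0r subr0.
have cQ := @continuous_stereo _ S1 w w0.
apply: closure_curve.
  apply: continuous_pair; last exact: cvg_cst.
  apply: continuous_pair; first exact: cQ.
  apply: cvgB; first exact: cvg_cst.
  apply: cvgZ; last exact: cQ.
  apply: (@continuous_comp _ _ _ Q (dotv P1)); first exact: cQ.
  exact: continuous_dotv.
have Q_inj : injective Q by exact: stereo_inj.
near=> t.
have QQ : dotv (Q t) (Q t) = 1 by exact: dotv_stereo.
(* S2, - S2 and the third point below are the only unit vectors q for which
   q and S2 are parallel or q + S2 is parallel to e. *)
have Q1 : Q t <> S2 by near: t; exact: near_injective_neq.
have Q2 : Q t <> - S2 by near: t; exact: near_injective_neq.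
have Q3 : Q t <> (2 * dotv e S2) *: e - S2.
  by near: t; exact: near_injective_neq.
split; last split.
- split; split=> //=; first exact/enorm1P.
  by rewrite dotvDl dotvNl dotvZl QQ mulr1 subrr.
- rewrite /int_angle /= -subr_eq0 subr_sqr_1 mulf_neq0 //; apply/eqP => h.
    apply: Q1; apply/subr0_eq/dotvv_eq0.
    by rewrite !(dotvDl, dotvDr, dotvNl, dotvNr) QQ S22 (dotvC S2); lra.
  apply: Q2; apply/subr0_eq/dotvv_eq0; rewrite opprK.
  by rewrite !(dotvDl, dotvDr) QQ S22 (dotvC S2); lra.
apply/eqP => /(crossv_eq0 ee); rewrite /spin_sum /=.
(* If Q t + S2 = l e, then |Q t| = 1 leaves only l = 0 and l = 2 e . S2, both excluded. *)
move: (dotv e _) => l hl.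
have {}hl : Q t = l *: e - S2 by rewrite -hl addrK.
have : l * (l - 2 * dotv e S2) = 0.
  move: QQ; rewrite hl !(dotvDl, dotvDr, dotvNl, dotvNr, dotvZl, dotvZr) ee S22.
  by rewrite (dotvC S2 e); lra.
move/eqP; rewrite mulf_eq0 => /orP[/eqP l0|].
  by apply: Q2; rewrite hl l0 scale0r add0r.
by rewrite subr_eq0 => /eqP l2; apply: Q3; rewrite hl l2.
Unshelve. all: by end_near. Qed.

(** With the spins fixed, pushing each P along S x n, where n = e x (S1 + S2), makes n . M affine in
    t. Its slope |S1 x n|^2 + |S2 x n|^2 is nonzero by [cross_unit_eq0], so n . M is nonzero for
    small t other than 0. *)
Lemma regular_dense_generic : generic_spins `<=` closure (regular `&` @TSS R).
Proof.
move=> [[S1 P1] [S2 P2]] [[[/= S11e PS1] [/= S22e PS2]] [angle n0]].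
have S11 : dotv S1 S1 = 1 by apply/enorm1P.
have S22 : dotv S2 S2 = 1 by apply/enorm1P.
pose n := crossv e (S1 + S2).
pose gamma t : TR3R3 R :=
  ((S1, P1 + t *: crossv S1 n), (S2, P2 + t *: crossv S2 n)).
have -> : ((S1, P1), (S2, P2)) = gamma 0 by rewrite /gamma !scale0r !addr0.
pose k := dotv (crossv S1 n) (crossv S1 n) + dotv (crossv S2 n) (crossv S2 n).
have k0 : k != 0.
  by apply: contra n0 => /eqP/(cross_unit_eq0 S11 S22 angle)/eqP.
pose d := dotv n (crossv P1 S1 + crossv P2 S2).
have dE t : dotv n (momentum (gamma t)) = d + t * k.
  rewrite /momentum /d /k /= !(crossvDl, crossvZl, dotvDr, dotvZr).
  rewrite -!(dotv_crossC _ _ n) -!(dotvC n).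
  by ring.
apply: closure_curve.
  have cP (P v : 'rV[R]_3) :
      {for (0 : R), continuous (fun t : R => P + t *: v)}.
    by apply: cvgD; [exact: cvg_cst|exact: scalel_continuous].
  by apply: continuous_pair; apply: continuous_pair;
    (exact: cP || exact: cvg_cst).
have inj : injective (fun t => d + t * k).
  by move=> t s /addrI/(mulIf k0).
near=> t.
have dt : d + t * k <> 0.
  by near: t; exact: (@near_injective_neq _ _ (fun t => d + t * k)).
split; split=> //.
- by rewrite dE; apply/eqP.
- by split=> //=; rewrite dotvDl dotvZl PS1 dotvC dotv_cross_self mulr0 addr0.
- by split=> //=; rewrite dotvDl dotvZl PS2 dotvC dotv_cross_self mulr0 addr0.
Unshelve. all: by end_near. Qed.

Lemma regular_dense : @TSS R `<=` closure (regular `&` @TSS R).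
Proof.
apply: subset_trans generic_spins_dense _.
rewrite [X in _ `<=` X](closure_id _).1; last exact: closed_closure.
exact: closureS regular_dense_generic.
Qed.

End Density.

Theorem theorem1 (R : realType) (mu : R) :
  completely_integrable 4 (@TSS R) (@tangentTSS R) (@wR3R3 R) (H_P mu).
Proof.
pose e : 'rV[R]_3 := delta_mx 0 0.
have ee : dotv e e = 1 by rewrite dotv_delta mxE !eqxx.
exists (integral e); split.
- exact: smooth_integral.
- by move=> i j x; exact: poisson_integral.
- by move=> i x; exact: poisson_H_integral.
exists (regular e); split.
- exact: open_regular.
- exact: regular_dense.
- by move=> x [[angle det] xM]; exact: indep_integral.
Qed.
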